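(* Let $b\in\mathbb{R}^n$ and let $T\in\mathbb{R}^{n\times n}$ be a nonsingular matrix. Assume that $\|T^{-1}\|<1$. Then the equation $$P_{\mathcal K}(x)+Tx=b,\qquad x\in\mathbb{R}^n,$$ has a unique solution $x^*\in\mathbb{R}^n$ and, for any starting point $x^0\in\mathbb{R}^n$, the semi-smooth Newton sequence $\{x^k\}$ generated by $$[V(x^k)+T]\,x^{k+1}=b,\qquad V(x^k)\in\partial_B P_{\mathcal K}(x^k),\qquad k=0,1,\ldots,$$ is well-defined. Additionally, if $\|T^{-1}\|<1/2$, then the sequence $\{x^k\}$ converges $Q$-linearly to $x^*$ as follows: $$\|x^*-x^{k+1}\|\le \frac{\|T^{-1}\|}{1-\|T^{-1}\|}\,\|x^*-x^k\|,\qquad k=0,1,\ldots.$$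
   Context: $\mathbb{R}^n$ carries the canonical inner product and Euclidean norm $\|\cdot\|$; for a matrix $E\in\mathbb{R}^{n\times n}$, $\|E\|=\max\{\|Ex\|: \|x\|=1\}$. $\mathcal K=\{x=(x_1,x_2)\in\mathbb{R}\times\mathbb{R}^{n-1}: \|x_2\|\le x_1\}$ is the second order cone and $P_{\mathcal K}$ is the Euclidean metric projection onto $\mathcal K$. For a locally Lipschitz map $F:\mathbb{R}^n\to\mathbb{R}^m$, with $D_F$ the set of points where $F$ is differentiable and $F'$ its Jacobian, the B-subdifferential is $\partial_BF(x)=\{V\in\mathbb{R}^{m\times n}: \exists\,\{x^k\}\subset D_F,\ x^k\to x,\ F'(x^k)\to V\}$. In the Newton iteration $V(x^k)$ is an arbitrary element of $\partial_BP_{\mathcal K}(x^k)$; ''well-defined'' means that the linear system at each step has a nonsingular matrix, so that $x^{k+1}$ exists and is unique, whatever the choice of $V(x^k)$. *)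

(* Defs.v *)
From HB Require Import structures.
From mathcomp Require Import all_boot all_order all_algebra.
From mathcomp Require Import all_classical all_reals all_analysis.
Import Order.TTheory GRing.Theory Num.Theory.
Import numFieldNormedType.Exports.

Set Implicit Arguments.
Unset Strict Implicit.
Unset Printing Implicit Defensive.

Local Open Scope classical_set_scope.
Local Open Scope ring_scope.

(** Vectors are column vectors.  The library's norm on matrices is the sup
    norm, so the Euclidean norm is defined here; the library's topology and
    its notion of differentiability do not depend on which of the two
    (equivalent) norms is used. *)

Definition enorm (R : realType) (n : nat) (x : 'cV[R]_n) : R :=
  Num.sqrt (\sum_i x i 0 ^+ 2).

(** The supremum is a maximum when the dimension is positive (the unit sphere
    is then nonempty and compact). *)
Definition opnorm (R : realType) (n : nat) (E : 'M[R]_n) : R :=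
  sup [set enorm (E *m x) | x in [set x : 'cV[R]_n | enorm x = 1]].

(** The ambient space has dimension [1 + n], so that [usubmx x] and [dsubmx x]
    are the blocks x_1 and x_2 of x = (x_1, x_2); for [n = 0] the cone is the
    half-line x_1 >= 0. *)
Definition soc (R : realType) (n : nat) : set 'cV[R]_(1 + n) :=
  [set x | enorm (dsubmx x) <= usubmx x 0 0].

(** A nearest point of [K]; it exists and is unique when [K] is nonempty,
    closed and convex. *)
Definition metric_proj (R : realType) (n : nat) (K : set 'cV[R]_n)
    (x : 'cV[R]_n) : 'cV[R]_n :=
  xget 0 [set y | K y /\ forall z, K z -> enorm (x - y) <= enorm (x - z)].

Definition proj_soc (R : realType) (n : nat) : 'cV[R]_(1 + n) -> 'cV[R]_(1 + n) :=
  metric_proj (@soc R n).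

(** The library's [jacobian] is for row vectors acting on the left; this is
    the usual m x n matrix, with ['d F x h = jacobian_cV F x *m h]. *)
Definition jacobian_cV (R : realType) (m n : nat) (F : 'cV[R]_n -> 'cV[R]_m)
    (x : 'cV[R]_n) : 'M[R]_(m, n) :=
  \matrix_(i < m, j < n) ('d F x (delta_mx j 0) : 'cV[R]_m) i 0.

Definition Bsubdiff (R : realType) (m n : nat) (F : 'cV[R]_n -> 'cV[R]_m)
    (x : 'cV[R]_n) : set 'M[R]_(m, n) :=
  [set V | exists u : nat -> 'cV[R]_n,
    [/\ forall k, differentiable F (u k),
        u @ \oo --> x &
        (fun k => jacobian_cV F (u k)) @ \oo --> V]].

Definition newton_step (R : realType) (n : nat) (F : 'cV[R]_n -> 'cV[R]_n)
    (T : 'M[R]_n) (b x y : 'cV[R]_n) : Prop :=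
  exists2 V, Bsubdiff F x V & (V + T) *m y = b.

(** Whatever choices were made in the first [N] steps from [x0], a choice of
    [V(x^N)] is available, and for every such choice the linear system is
    nonsingular and so determines [x^{N+1}].  Only the values [x 0], ..., [x N]
    of the sequence [x] matter. *)
Definition newton_well_defined (R : realType) (n : nat)
    (F : 'cV[R]_n -> 'cV[R]_n) (T : 'M[R]_n) (b x0 : 'cV[R]_n) : Prop :=
  forall (x : nat -> 'cV[R]_n) (N : nat),
    x 0%N = x0 ->
    (forall k, (k < N)%N -> newton_step F T b (x k) (x k.+1)) ->
    Bsubdiff F (x N) !=set0 /\
    (forall V, Bsubdiff F (x N) V ->
       V + T \in unitmx /\ exists! y : 'cV[R]_n, (V + T) *m y = b).

Definition newton_sequence (R : realType) (n : nat)
    (F : 'cV[R]_n -> 'cV[R]_n) (T : 'M[R]_n) (b x0 : 'cV[R]_n)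
    (x : nat -> 'cV[R]_n) : Prop :=
  x 0%N = x0 /\ forall k, newton_step F T b (x k) (x k.+1).

Definition Qlinear_cvg (R : realType) (n : nat) (x : nat -> 'cV[R]_n)
    (l : 'cV[R]_n) (c : R) : Prop :=
  [/\ 0 <= c < 1,
      x @ \oo --> l &
      forall k, enorm (l - x k.+1) <= c * enorm (l - x k)].

(* Main.v *)
Require Import Defs.
From HB Require Import structures.
From mathcomp Require Import all_boot all_order all_algebra.
From mathcomp Require Import all_classical all_reals all_analysis.
From mathcomp Require Import ring lra.
Import Order.TTheory GRing.Theory Num.Theory.
Import numFieldNormedType.Exports.
Local Open Scope classical_set_scope.
Local Open Scope ring_scope.

(* The projection P onto the cone is firmly nonexpansive, i.e.
   |2 (P y - P x) - (y - x)| <= |y - x|, and positively homogeneous.  Both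
   properties pass to Jacobians and their limits: every V in the
   B-subdifferential at x satisfies |2 V h - h| <= |h| and V x = P x.  Hence
   |V h| <= |h|, which makes V + T nonsingular when |T^-1| < 1, and
   |P y - P x - V (y - x)| <= |y - x|, which bounds the Newton error e' after a
   step in terms of the error e before it: since
   T e' = - (P x* - P x - V (x* - x)) - V e', we get
   |e'| <= |T^-1| (|e| + |e'|).  The equation itself is the fixed point problem
   of the contraction x |-> T^-1 (b - P x). *)

(** * Euclidean inner product and norm, and comparison with the sup norm *)

Section EuclideanSpace.
Context {R : realType} {n : nat}.
Implicit Types (x y z : 'cV[R]_n) (a : R).

Definition dot x y : R := \sum_i x i 0 * y i 0.

Lemma dotC x y : dot x y = dot y x.
Proof. by apply: eq_bigr => i _; rewrite mulrC. Qed.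

Lemma dotDl x y z : dot (x + y) z = dot x z + dot y z.
Proof. by rewrite -big_split; apply: eq_bigr => i _; rewrite mxE mulrDl. Qed.

Lemma dotZl a x y : dot (a *: x) y = a * dot x y.
Proof. by rewrite mulr_sumr; apply: eq_bigr => i _; rewrite mxE mulrA. Qed.

Lemma dotDr x y z : dot z (x + y) = dot z x + dot z y.
Proof. by rewrite dotC dotDl !(dotC z). Qed.

Lemma dotZr a x y : dot x (a *: y) = a * dot x y.
Proof. by rewrite dotC dotZl dotC. Qed.

Lemma dotNl x y : dot (- x) y = - dot x y.
Proof. by rewrite -scaleN1r dotZl mulN1r. Qed.

Lemma dotNr x y : dot x (- y) = - dot x y.
Proof. by rewrite dotC dotNl dotC. Qed.

Lemma dotBl x y z : dot (x - y) z = dot x z - dot y z.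
Proof. by rewrite dotDl dotNl. Qed.

Lemma dotBr x y z : dot z (x - y) = dot z x - dot z y.
Proof. by rewrite dotDr dotNr. Qed.

Lemma dotv_ge0 x : 0 <= dot x x.
Proof. by apply: sumr_ge0 => i _; rewrite -expr2 sqr_ge0. Qed.

Lemma dotv_eq0 x : (dot x x == 0) = (x == 0).
Proof.
apply/eqP/eqP => [x0|->]; last by rewrite -[0](scale0r 0) dotZl mul0r.
apply/colP => i; rewrite mxE; apply/eqP; rewrite -sqrf_eq0 expr2; apply/eqP.
by move/psumr_eq0P : x0; apply => // j _; rewrite -expr2 sqr_ge0.
Qed.

Lemma enorm_ge0 x : 0 <= enorm x.
Proof. exact: sqrtr_ge0. Qed.

Lemma enorm_sqr x : enorm x ^+ 2 = dot x x.
Proof.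
by rewrite sqr_sqrtr ?sumr_ge0// => i _; rewrite sqr_ge0.
Qed.

Lemma enorm_eq0 x : (enorm x == 0) = (x == 0).
Proof. by rewrite -sqrf_eq0 enorm_sqr dotv_eq0. Qed.

Lemma enorm0 : enorm (0 : 'cV[R]_n) = 0.
Proof. by apply/eqP; rewrite enorm_eq0. Qed.

Lemma enorm_gt0 x : (0 < enorm x) = (x != 0).
Proof. by rewrite lt_neqAle enorm_ge0 andbT eq_sym enorm_eq0. Qed.

Lemma enormZ a x : enorm (a *: x) = `|a| * enorm x.
Proof.
apply/eqP; rewrite -(eqrXn2 (n := 2))// ?mulr_ge0 ?enorm_ge0//.
by rewrite exprMn !enorm_sqr dotZl dotZr mulrA -expr2 real_normK ?num_real.
Qed.

Lemma enormN x : enorm (- x) = enorm x.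
Proof. by rewrite -scaleN1r enormZ normrN1 mul1r. Qed.

Lemma enormB x y : enorm (x - y) = enorm (y - x).
Proof. by rewrite -enormN opprB. Qed.

Lemma ler_enorm x y : (enorm x <= enorm y) = (dot x x <= dot y y).
Proof. by rewrite -!enorm_sqr ler_sqr ?nnegrE ?enorm_ge0. Qed.

Lemma dot_le_enorm x y : dot x y <= enorm x * enorm y.
Proof.
have [->|x0] := eqVneq x 0.
  by rewrite enorm0 mul0r -[0](scale0r 0) dotZl mul0r.
have [->|y0] := eqVneq y 0.
  by rewrite enorm0 mulr0 -[0](scale0r 0) dotZr mul0r.
(* Cauchy-Schwarz: this square expands to 2 |x| |y| (|x| |y| - <x, y>), and the first factors are
   positive. *)
have := dotv_ge0 (enorm y *: x - enorm x *: y).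
rewrite dotBl !dotBr !dotZl !dotZr -!enorm_sqr (dotC y x).
move: x0 y0; rewrite -!enorm_gt0; set p := enorm x; set q := enorm y => p0 q0.
rewrite (_ : _ - _ = 2 * (p * q) * (p * q - dot x y)); last by ring.
by rewrite pmulr_rge0 ?subr_ge0// !mulr_gt0.
Qed.

Lemma ler_enormD x y : enorm (x + y) <= enorm x + enorm y.
Proof.
rewrite -ler_sqr ?nnegrE ?addr_ge0 ?enorm_ge0// sqrrD !enorm_sqr dotDl !dotDr.
have := dot_le_enorm x y; rewrite (dotC y x).
by move: (dot x x) (dot y y) (dot x y) (_ * _) => a b c d; lra.
Qed.

Lemma ler_enormB x y : enorm (x - y) <= enorm x + enorm y.
Proof. by rewrite (le_trans (ler_enormD _ _))// enormN. Qed.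

Lemma coord_le_enorm x i : `|x i 0| <= enorm x.
Proof.
rewrite -ler_sqr ?nnegrE ?enorm_ge0// real_normK ?num_real// enorm_sqr.
rewrite /dot (bigD1 i)//= -expr2 lerDl sumr_ge0// => j _.
by rewrite -expr2 sqr_ge0.
Qed.

Lemma mx_norm_le_enorm x : `|x| <= enorm x.
Proof.
change (`|x|%R) with (mx_norm x).
have [->|/mx_norm_neq0[[i j] ->/=]] := eqVneq (mx_norm x) 0.
  exact: enorm_ge0.
by rewrite (ord1 j) coord_le_enorm.
Qed.

(** The triangle inequality for the expansion in the canonical basis. The factor [n] is not sharp;
    only equivalence of the two norms matters below. *)
Lemma enorm_le_mx_norm x : enorm x <= n%:R * `|x|.
Proof.
have [e xe] : exists e : 'I_n -> 'cV[R]_n, x = \sum_i x i 0 *: e i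
    /\ forall i, enorm (e i) <= 1.
  exists (fun i => delta_mx i 0); split.
    rewrite {1}(matrix_sum_delta x); apply: eq_bigr => i _.
    by rewrite big_ord1.
  move=> i; rewrite -[leRHS]ger0_norm// -ler_sqr ?nnegrE ?enorm_ge0//.
  rewrite enorm_sqr normr1 expr1n /dot (bigD1 i)//= mxE !eqxx mulr1.
  rewrite big1 ?addr0// => j ji.
  by rewrite mxE (negbTE ji) mul0r.
have [{1}-> e1] := xe.
apply: (@le_trans _ _ (\sum_i enorm (x i 0 *: e i))).
  elim/big_ind2: _ => [|u a v c ua vc|//]; first by rewrite enorm0.
  exact: le_trans (ler_enormD _ _) (lerD ua vc).
have -> : n%:R = \sum_(i < n) 1 :> R by rewrite sumr_const card_ord.
rewrite mulr_suml.
apply: ler_sum => i _; rewrite enormZ mul1r -[leRHS]mulr1.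
rewrite ler_pM// ?enorm_ge0//.
change (`|x|%R) with (mx_norm x); rewrite /mx_norm.
rewrite -[leLHS]nngE num_le.
exact: (le_bigmax _ (fun ij : 'I_n * 'I_1 => `|x ij.1 ij.2|%:nng) (i, 0)).
Qed.

End EuclideanSpace.

(** * Entrywise convergence of matrices and the operator norm *)

Lemma cvg_coord {R : realType} (I : Type) (F : set_system I) {FF : Filter F}
    m n (M : I -> 'M[R]_(m, n)) (L : 'M[R]_(m, n)) i j :
  M @ F --> L -> M k i j @[k --> F] --> L i j.
Proof.
move=> ML; have cc : {for L, continuous (fun A : 'M[R]_(m, n) => A i j)}.
  exact: coord_continuous.
exact: (@cvg_comp _ _ _ M (fun A : 'M[R]_(m, n) => A i j) F (nbhs L) _ ML cc).
Qed.

Section OperatorNorm.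
Context {R : realType} {n : nat}.

(** A nonzero sup norm is attained at an entry, and there are finitely many entries, so the eventual
    bounds hold simultaneously. *)
Lemma cvg_mxP (I : Type) (F : set_system I) {FF : ProperFilter F} m
    (M : I -> 'M[R]_(m, n)) (L : 'M[R]_(m, n)) :
  (forall i j, M k i j @[k --> F] --> L i j) -> M @ F --> L.
Proof.
move=> ML; apply/cvgrPdist_lt => e e0; near=> k.
have [->//|/mx_norm_neq0[[i j] /= h]] := eqVneq `|L - M k| 0.
rewrite -[`|_|]/(mx_norm _) h !mxE.
move: i j {h}; near: k.
have : \forall k \near F, forall ij : 'I_m * 'I_n,
    `|L ij.1 ij.2 - M k ij.1 ij.2| < e.
  by apply: filter_forall => ij; move/cvgrPdist_lt: (ML ij.1 ij.2); apply.
by apply: filterS => k h i j; exact: (h (i, j)).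
Unshelve. all: by end_near. Qed.

Lemma cvg_mulmx (I : Type) (F : set_system I) {FF : ProperFilter F} m p
    (M : I -> 'M[R]_(m, p)) (N : I -> 'M[R]_(p, n))
    (K : 'M[R]_(m, p)) (L : 'M[R]_(p, n)) :
  M @ F --> K -> N @ F --> L -> M k *m N k @[k --> F] --> K *m L.
Proof.
move=> MK NL; apply: cvg_mxP => i j; rewrite mxE.
under eq_fun do rewrite mxE.
apply: cvg_big => [|k _]; first exact: add_continuous.
apply: cvgM.
  exact: cvg_coord.
exact: cvg_coord.
Qed.

Lemma enorm_continuous : continuous (@enorm R n).
Proof.
have sum_cont : continuous (fun x : 'cV[R]_n => \sum_i x i 0 ^+ 2).
  apply: continuous_big => [|i _ x]; first exact: add_continuous.
  apply: (@continuous_comp _ _ _ (fun y : 'cV[R]_n => y i 0) (fun a => a ^+ 2)).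
    exact: coord_continuous.
  exact: exprn_continuous.
by move=> x; apply: continuous_comp (sum_cont x) _; exact: sqrt_continuous.
Qed.

End OperatorNorm.

Lemma enorm_mulmx_le {R : realType} {n : nat} (E : 'M[R]_n) x :
  enorm (E *m x) <= opnorm E * enorm x.
Proof.
have [->|x0] := eqVneq x 0; first by rewrite mulmx0 enorm0 mulr0.
pose y := (enorm x)^-1 *: x.
have ex : 0 < enorm x by rewrite enorm_gt0.
have y1 : enorm y = 1 by rewrite enormZ gtr0_norm ?invr_gt0// mulVf ?gt_eqF.
rewrite -ler_pdivrMr// -[(enorm x)^-1]gtr0_norm ?invr_gt0// mulrC -enormZ.
rewrite scalemxAr -/y; apply: ub_le_sup; last by exists y.
(* The supremum bounds its members only if the set is bounded above. Coordinates of a unit vector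
   are at most 1, so the double sum bounds every entry of [E *m z]; [n] converts to the Euclidean
   norm. *)
exists (n%:R * \sum_i \sum_j `|E i j|) => _ [z z1 <-].
apply: (le_trans (enorm_le_mx_norm _)); rewrite ler_wpM2l//.
change (`|E *m z|%R) with (mx_norm (E *m z)).
have [->|/mx_norm_neq0[[i j] ->/=]] := eqVneq (mx_norm (E *m z)) 0.
  by do 2!(apply: sumr_ge0 => ? _).
rewrite (ord1 j) mxE (le_trans (ler_norm_sum _ _ _))//.
rewrite [leRHS](bigD1 i)//= -[leLHS]addr0 lerD//; last first.
  by do 2!(apply: sumr_ge0 => ? _).
apply: ler_sum => k _; rewrite normrM -[leRHS]mulr1 ler_wpM2l//.
by rewrite -z1 coord_le_enorm.
Qed.

Lemma opnorm_ge0 {R : realType} {n : nat} (E : 'M[R]_(1 + n)) : 0 <= opnorm E.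
Proof.
have := enorm_mulmx_le E (delta_mx 0 0).
move/(le_trans (enorm_ge0 _)); rewrite pmulr_lge0// enorm_gt0.
apply/eqP => /matrixP/(_ 0 0); rewrite !mxE eqxx => /eqP.
by rewrite oner_eq0.
Qed.

(** * Firmly nonexpansive homogeneous maps and their B-subdifferentials *)

Section FirmlyNonexpansive.
Context {R : realType} {n : nat} (F : 'cV[R]_n -> 'cV[R]_n).
Implicit Types (x y u h : 'cV[R]_n) (V : 'M[R]_n).

Lemma jacobian_cVE u h : differentiable F u ->
  'd F u h = jacobian_cV F u *m h.
Proof.
move=> dF; rewrite {1}(matrix_sum_delta h) linear_sum; apply/colP => i.
rewrite summxE mxE; apply: eq_bigr => j _.
by rewrite big_ord1 linearZ !mxE mulrC.
Qed.

Lemma cvg_jacobian_cV u h : differentiable F u ->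
  t^-1 *: (F (t *: h + u) - F u) @[t --> 0^'] --> jacobian_cV F u *m h.
Proof.
move=> dF; rewrite -jacobian_cVE// -deriveE//.
exact: (diff_derivable dF).
Qed.

(** Nonexpansiveness of the reflection 2 F - id, equivalent to |F y - F x|^2 <= <F y - F x, y - x>.
    In this form it passes directly to difference quotients and their limits. *)
Definition firmly_nonexpansive :=
  forall x y, enorm (2 *: (F y - F x) - (y - x)) <= enorm (y - x).

Definition positively_homogeneous :=
  forall (a : R) x, 0 <= a -> F (a *: x) = a *: F x.

Hypothesis Ffirm : firmly_nonexpansive.

(** [F y - F x] is half the sum of [2 *: (F y - F x) - (y - x)] and [y - x]. *)
Lemma firmly_nonexpansive_le x y : enorm (F y - F x) <= enorm (y - x).
Proof.
rewrite -[F y - F x](@scalerK _ _ 2)//.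
rewrite -[2 *: _](subrK (y - x)) enormZ ger0_norm ?invr_ge0//.
rewrite mulrC ler_pdivrMr// mulr_natr mulr2n (le_trans (ler_enormD _ _))//.
by rewrite lerD2r Ffirm.
Qed.

Lemma firmly_nonexpansive_cvg (I : Type) (G : set_system I) {GG : Filter G}
    (u : I -> 'cV[R]_n) x : u @ G --> x -> F (u k) @[k --> G] --> F x.
Proof.
move=> ux; apply/cvgrPdist_lt => e e0.
(* [n.+1] instead of [n] keeps the divisor positive in dimension 0. *)
have n0 : 0 < n.+1%:R :> R by rewrite ltr0n.
have /cvgrPdist_lt/(_ (e / n.+1%:R)) := ux.
rewrite divr_gt0// => /(_ isT); apply: filterS => k.
rewrite ltr_pdivlMr// mulrC; apply: le_lt_trans.
apply: (le_trans (mx_norm_le_enorm _)).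
apply: (le_trans (firmly_nonexpansive_le _ _)).
by apply: (le_trans (enorm_le_mx_norm _)); rewrite ler_wpM2r// ler_nat.
Qed.

Lemma jacobian_firm u h : differentiable F u ->
  enorm (2 *: (jacobian_cV F u *m h) - h) <= enorm h.
Proof.
move=> dF.
have cvgJ : 2 *: (t^-1 *: (F (t *: h + u) - F u)) - h @[t --> 0^'] -->
    2 *: (jacobian_cV F u *m h) - h.
  by apply: cvgB; [apply: cvgZl_tmp; exact: cvg_jacobian_cV|exact: cvg_cst].
apply: (cvgr_to_le (continuous_cvg _ (enorm_continuous _) cvgJ)).
near=> t.
have t0 : t != 0 by near: t; exact: nbhs_dnbhs_neq.
(* Multiplied by |t|, the bound on the difference quotient is [Ffirm] at the points [u] and
   [t *: h + u]. *)
rewrite -(ler_pM2l (x := `|t|)) ?normr_gt0// -!enormZ scalerBr.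
rewrite !scalerA mulrCA divff// mulr1.
by have := Ffirm u (t *: h + u); rewrite addrK.
Unshelve. all: by end_near. Qed.

Lemma Bsubdiff_firm x V h : Bsubdiff F x V ->
  enorm (2 *: (V *m h) - h) <= enorm h.
Proof.
move=> [u [dF _ uV]].
have cvgV : 2 *: (jacobian_cV F (u k) *m h) - h @[k --> \oo] -->
    2 *: (V *m h) - h.
  apply: cvgB; last exact: cvg_cst.
  by apply: cvgZl_tmp; apply: cvg_mulmx uV _; exact: cvg_cst.
apply: (cvgr_to_le (continuous_cvg _ (enorm_continuous _) cvgV)).
by apply: nearW => k; exact: jacobian_firm.
Qed.

Lemma Bsubdiff_nonexpansive x V h : Bsubdiff F x V -> enorm (V *m h) <= enorm h.
Proof.
move=> /(@Bsubdiff_firm _ _ h) Vh.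
rewrite -[V *m h](@scalerK _ _ 2)//.
rewrite -[2 *: _](subrK h) enormZ ger0_norm ?invr_ge0//.
rewrite mulrC ler_pdivrMr// mulr_natr mulr2n (le_trans (ler_enormD _ _))//.
by rewrite lerD2r.
Qed.

(* Both [2 (F y - F x) - (y - x)] and [2 V (y - x) - (y - x)] have norm at most
   [enorm (y - x)], and the remainder is half of their difference. *)
Lemma Bsubdiff_remainder_le x y V : Bsubdiff F x V ->
  enorm (F y - F x - V *m (y - x)) <= enorm (y - x).
Proof.
move=> /(@Bsubdiff_firm _ _ (y - x)) Vyx.
rewrite (_ : _ - V *m _ = 2^-1 *: ((2 *: (F y - F x) - (y - x)) -
    (2 *: (V *m (y - x)) - (y - x)))); last first.
  by rewrite [- (2 *: _ - _)]opprB subrKA -scalerBr scalerK.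
rewrite enormZ ger0_norm ?invr_ge0// mulrC ler_pdivrMr// mulr_natr mulr2n.
by rewrite (le_trans (ler_enormB _ _))// lerD.
Qed.

Hypothesis Fhom : positively_homogeneous.

(** Euler's identity in degree 1: for |t| < 1 the scalar 1 + t is nonnegative, so the difference
    quotient in direction [u] is constantly [F u]. *)
Lemma jacobian_homogeneous u : differentiable F u -> jacobian_cV F u *m u = F u.
Proof.
move=> dF; have := cvg_jacobian_cV u u dF.
move/(cvg_unique (@norm_hausdorff _ _)); apply.
apply: cvg_near_cst; near=> t.
have t0 : t != 0 by near: t; exact: nbhs_dnbhs_neq.
have t1 : `|t| < 1.
  near: t; exact: dnbhs0_lt.
rewrite -{2}[u]scale1r -scalerDl Fhom; last first.
  by move: t1; rewrite ltr_norml => /andP[]; lra.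
by rewrite scalerDl scale1r addrK scalerA mulVf// scale1r.
Unshelve. all: by end_near. Qed.

(** By Euler's identity [F (u k)] is the Jacobian at [u k] applied to [u k], which tends to
    [V *m x]; by continuity it also tends to [F x]. *)
Lemma Bsubdiff_homogeneous x V : Bsubdiff F x V -> V *m x = F x.
Proof.
move=> [u [dF ux uV]].
have FV : F (u k) @[k --> \oo] --> V *m x.
  under eq_fun do rewrite -(jacobian_homogeneous _ (dF _)).
  exact: cvg_mulmx.
apply: (cvg_unique (@norm_hausdorff _ _) FV).
exact: firmly_nonexpansive_cvg.
Qed.

End FirmlyNonexpansive.

(** * Fixed points of contractions in the Euclidean norm *)

Lemma enorm_contraction_fixpoint {R : realType} {n : nat}
    (g : 'cV[R]_n -> 'cV[R]_n) (c : R) : 0 <= c < 1 ->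
  (forall x y, enorm (g x - g y) <= c * enorm (x - y)) -> exists p, g p = p.
Proof.
move=> /andP[c0 c1] gc.
have iter_le N x y : enorm (iter N g x - iter N g y) <= c ^+ N * enorm (x - y).
  elim: N => [|N IH]; first by rewrite mul1r.
  by rewrite (le_trans (gc _ _))// exprS -mulrA ler_wpM2l.
have [N cN] : exists N, c ^+ N * n.+1%:R < 1.
  have : c ^+ N * n.+1%:R @[N --> \oo] --> (0 * n.+1%:R : R).
    by apply: cvgMr_tmp; apply: cvg_expr; rewrite ger0_norm.
  rewrite mul0r => /cvgrPdist_lt/(_ _ ltr01)[N _ /(_ N (leqnn N))] /=.
  by rewrite sub0r normrN => cN; exists N; apply: le_lt_trans cN; exact: ler_norm.
(* The sup norm and the Euclidean norm differ by a factor [n], which a high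
   iterate of the contraction absorbs. *)
pose f : {fun [set: 'cV[R]_n] >-> [set: 'cV[R]_n]} := totalfun_ setT (iter N g).
have q0 : 0 <= c ^+ N * n.+1%:R by rewrite mulr_ge0// exprn_ge0.
have fc : is_contraction f.
  exists (NngNum q0); split => //= -[x y] _ /=.
  apply: (le_trans (mx_norm_le_enorm _)); apply: (le_trans (iter_le _ _ _)).
  rewrite -mulrA ler_wpM2l ?exprn_ge0//; apply: le_trans (enorm_le_mx_norm _) _.
  by rewrite ler_wpM2r// ler_nat.
pose X : completeNormedModType R := HB.pack 'cV[R]_n.
have [] := @banach_fixed_point R X setT f fc closedT; first by exists 0.
(* The iterate fixes both [p] and [g p], so |g p - p| <= c^N |g p - p| with c^N < 1. *)
move=> p _ pN; exists p; apply/eqP; rewrite -subr_eq0 -enorm_eq0.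
have := iter_le N (g p) p; rewrite -iterSr iterS -[iter N g p]pN.
apply: contraTT => p0; rewrite -ltNge gtr_pMl; last first.
  by rewrite enorm_gt0 -enorm_eq0.
by apply: le_lt_trans cN; rewrite ler_peMr ?exprn_ge0// ler1n.
Qed.

(** * The projection onto the second order cone in closed form *)

Section SecondOrderCone.
Context {R : realType} {n : nat}.
Implicit Types (x y u v p q : 'cV[R]_(1 + n)) (a : R).

Lemma head_scale a x : usubmx (a *: x) 0 0 = a * usubmx x 0 0.
Proof. by rewrite !mxE. Qed.

Lemma head_opp x : usubmx (- x) 0 0 = - usubmx x 0 0.
Proof. by rewrite !mxE. Qed.

Lemma head_sub x y : usubmx (x - y) 0 0 = usubmx x 0 0 - usubmx y 0 0.
Proof. by rewrite !mxE. Qed.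

Lemma tail_scale a x : dsubmx (a *: x) = a *: dsubmx x.
Proof. by apply/colP => i; rewrite !mxE. Qed.

Lemma tail_opp x : dsubmx (- x) = - dsubmx x.
Proof. by apply/colP => i; rewrite !mxE. Qed.

Lemma tail_sub x y : dsubmx (x - y) = dsubmx x - dsubmx y.
Proof. by apply/colP => i; rewrite !mxE. Qed.

Lemma soc0 : soc (0 : 'cV[R]_(1 + n)).
Proof.
rewrite /soc/= [dsubmx _](_ : _ = 0) ?enorm0 ?mxE//.
by apply/colP => i; rewrite !mxE.
Qed.

Lemma dot_block x y :
  dot x y = usubmx x 0 0 * usubmx y 0 0 + dot (dsubmx x) (dsubmx y).
Proof.
rewrite /dot big_split_ord big_ord1 !mxE; congr (_ + _).
by apply: eq_bigr => i _; rewrite !mxE.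
Qed.

Lemma soc_scale a x : 0 <= a -> soc x -> soc (a *: x).
Proof.
move=> a0; rewrite /soc/= head_scale tail_scale enormZ ger0_norm//.
exact: ler_wpM2l.
Qed.

(** One half of self-duality: by Cauchy-Schwarz the tails contribute at least -|x_2| |y_2|, and the
    heads at least |x_2| |y_2|. *)
Lemma soc_dot_ge0 x y : soc x -> soc y -> 0 <= dot x y.
Proof.
rewrite /soc/= dot_block => x21 y21.
have := dot_le_enorm (- dsubmx x) (dsubmx y); rewrite dotNl enormN lerNl.
rewrite -subr_ge0 opprK => h; rewrite addrC; apply: le_trans h _.
by rewrite lerD2l ler_pM// enorm_ge0.
Qed.

(** Moreau's decomposition. In |x - z|^2 the cross term is 2 <z, p - x>, nonnegative by
    self-duality, so every [z] in the cone is farther from [x] than [p], with excess at least |z -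
    p|^2. *)
Lemma proj_soc_unique x p :
  soc p -> soc (p - x) -> dot p (p - x) = 0 -> proj_soc x = p.
Proof.
move=> Kp Kpx pp.
have dist z : soc z -> enorm (x - p) ^+ 2 + enorm (z - p) ^+ 2 <= enorm (x - z) ^+ 2.
  move=> Kz; have -> : x - z = (x - p) - (z - p) by rewrite opprB subrKA.
  have zpx : 0 <= dot z (p - x) by exact: soc_dot_ge0.
  have pxz : dot (x - p) (z - p) = - dot z (p - x).
    by rewrite -(opprB p x) dotNl dotBr (dotC _ p) pp subr0 dotC.
  rewrite !enorm_sqr (dotBl (x - p)) !(dotBr (x - p) (z - p)).
  rewrite (dotC (z - p) (x - p)) pxz.
  by move: (dot z _) (dot (x - p) _) (dot (z - p) _) zpx => ? ? ?; lra.
(* Either [xget] picks a nearest point [q], which the excess forces to equal [p], or it falls back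
   on its default because none exists, which [p] refutes. *)
rewrite /proj_soc /metric_proj; case: xgetP => [q _ [Kq qmin]|/(_ p) /=].
  have := dist q Kq; have := qmin p Kp.
  rewrite -ler_sqr ?nnegrE ?enorm_ge0// => qp pq.
  have : enorm (q - p) ^+ 2 <= 0.
    by move: (enorm (x - q) ^+ 2) (enorm (x - p) ^+ 2) (enorm (q - p) ^+ 2)
       pq qp => ? ? ?; lra.
  rewrite le_eqVlt ltNge sqr_ge0 orbF sqrf_eq0 enorm_eq0 subr_eq0.
  by move/eqP.
case; split=> // z Kz; rewrite -ler_sqr ?nnegrE ?enorm_ge0//.
by apply: le_trans (dist z Kz); rewrite lerDl sqr_ge0.
Qed.

Lemma proj_soc_id x : soc x -> proj_soc x = x.
Proof.
move=> Kx; apply: proj_soc_unique => //; rewrite subrr.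
  exact: soc0.
by rewrite -[0](scale0r 0) dotZr mul0r.
Qed.

Lemma proj_soc_eq0 x : soc (- x) -> proj_soc x = 0.
Proof.
move=> Kx; apply: proj_soc_unique; rewrite ?sub0r//.
  exact: soc0.
by rewrite -[0](scale0r 0) dotZl mul0r.
Qed.

(** The orthogonal projection of [x] onto the line spanned by (1, x_2 / r), which is a boundary
    direction of the cone when r > 0. *)
Definition soc_side x : 'cV[R]_(1 + n) :=
  let r := enorm (dsubmx x) in let a := (usubmx x 0 0 + r) / 2 in
  col_mx a%:M ((a / r) *: dsubmx x).

(** Here [p - x] is (r - x_1) / 2 times (1, - x_2 / r), so [p] and [p - x] lie on two orthogonal
    boundary rays of the cone. *)
Lemma soc_sideP x (r := enorm (dsubmx x)) (p := soc_side x) :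
    usubmx x 0 0 < r -> - usubmx x 0 0 < r ->
  [/\ soc p, soc (p - x) & dot p (p - x) = 0].
Proof.
rewrite /soc/= /p; set x1 := usubmx x 0 0 => x1r x1Nr.
have r0 : 0 < r by lra.
have rx1 : 0 <= (x1 + r) / 2 by lra.
have rne0 : r != 0 by rewrite gt_eqF.
have p1 : usubmx (soc_side x) 0 0 = (x1 + r) / 2.
  by rewrite col_mxKu mxE eqxx mulr1n.
have p2 : dsubmx (soc_side x) = ((x1 + r) / 2 / r) *: dsubmx x.
  by rewrite col_mxKd.
rewrite dot_block head_sub tail_sub p1 p2.
have p3 c : c *: dsubmx x - dsubmx x = (c - 1) *: dsubmx x.
  by rewrite scalerBl scale1r.
rewrite p3 !enormZ -/r -/x1.
rewrite dotZl dotZr -enorm_sqr -/r; split.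
- by rewrite (ger0_norm (divr_ge0 rx1 (ltW r0))) divfK.
- have c1 : (x1 + r) / 2 / r <= 1 by rewrite ler_pdivrMr// mul1r; lra.
  by rewrite ler0_norm ?subr_le0// mulNr mulrBl divfK// mul1r; lra.
- by field.
Qed.

Lemma proj_soc_side x : usubmx x 0 0 < enorm (dsubmx x) ->
  - usubmx x 0 0 < enorm (dsubmx x) -> proj_soc x = soc_side x.
Proof. by move=> h1 h2; have [] := soc_sideP x h1 h2; exact: proj_soc_unique. Qed.

Lemma soc_trichotomy x : [\/ soc x, soc (- x) |
  usubmx x 0 0 < enorm (dsubmx x) /\ - usubmx x 0 0 < enorm (dsubmx x)].
Proof.
rewrite /soc/= head_opp tail_opp enormN.
have [h|h1] := leP (enorm (dsubmx x)) (usubmx x 0 0); first exact: Or31.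
have [h|h2] := leP (enorm (dsubmx x)) (- usubmx x 0 0); first exact: Or32.
exact: Or33.
Qed.

(** Converse of [proj_soc_unique]: each of the three regions has an explicit point satisfying the
    conditions, so no compactness argument is involved. *)
Lemma proj_socP x (p := proj_soc x) :
  [/\ soc p, soc (p - x) & dot p (p - x) = 0].
Proof.
have K0 := soc0.
have dot0 y : dot y 0 = 0 by rewrite -[0 in LHS](scale0r 0) dotZr mul0r.
rewrite /p; have [Kx|Kx|[h1 h2]] := soc_trichotomy x.
- by rewrite proj_soc_id// subrr.
- by rewrite proj_soc_eq0// sub0r dotC.
- by rewrite proj_soc_side//; exact: soc_sideP.
Qed.

Lemma proj_soc_firm : firmly_nonexpansive (@proj_soc R n).
Proof.
move=> x y; have [Kp Kpx pp] := proj_socP x; have [Kq Kqy qq] := proj_socP y.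
move: Kp Kpx pp Kq Kqy qq; set p := proj_soc x; set q := proj_soc y.
move=> Kp Kpx pp Kq Kqy qq; rewrite ler_enorm.
(* By orthogonality the last inner product is - <q, p - x> - <p, q - y>, which self-duality makes
   nonpositive. *)
have -> : dot (2 *: (q - p) - (y - x)) (2 *: (q - p) - (y - x)) =
    dot (y - x) (y - x) + 4 * dot (q - p) ((q - y) - (p - x)).
  have -> : (q - y) - (p - x) = (q - p) - (y - x).
    by rewrite !opprB addrACA [RHS]addrACA; congr (_ + _); rewrite addrC.
  move: (q - p) (y - x) => d w.
  rewrite !dotBl !dotBr !dotZl !dotZr (dotC w d).
  by move: (dot d d) (dot d w) (dot w w) => ? ? ?; ring.
rewrite gerDl pmulr_rle0// dotBr !dotBl qq pp.
have := soc_dot_ge0 _ _ Kq Kpx; have := soc_dot_ge0 _ _ Kp Kqy.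
by move: (dot p _) (dot q _) => ? ?; lra.
Qed.

Lemma proj_soc_homogeneous : positively_homogeneous (@proj_soc R n).
Proof.
move=> a x a0; have [Kp Kpx pp] := proj_socP x.
apply: proj_soc_unique; rewrite -?scalerBr; try exact: soc_scale.
by rewrite dotZl dotZr pp !mulr0.
Qed.

End SecondOrderCone.

(** * Differentiability of the projection and nonemptiness of its B-subdifferential *)

Lemma near_eq_diff {R : numFieldType} {V W : normedModType R} (f g : V -> W) x :
  (\near x, f x = g x) -> differentiable f x ->
  differentiable g x /\ 'd g x = 'd f x :> (V -> W).
Proof.
move=> fg df; have fgx := nbhs_singleton fg.
(* The first-order expansion of [f] is also one of [g], as the two agree near [x]; uniqueness of the
   differential then identifies it. *)
have gE : g \o shift x = cst (g x) + 'd f x +o_ 0 id.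
  move/diff_locallyP : df => [_ /eqaddoP fo].
  apply/eqaddoP => e e0; have := fo e e0.
  have fgs : \forall y \near 0, f (y + x) = g (y + x).
    by rewrite (near_shift x); near do rewrite /= sub0r addrNK.
  apply: filterS2 fgs => y fgy.
  by rewrite /= !fctE /= fgy fgx.
have dc : continuous ('d f x) by exact: diff_continuous.
have dg := diff_unique dc gE.
split; last exact: dg.
by apply/diff_locallyP; rewrite dg; split; [exact: dc|exact: gE].
Unshelve. all: by end_near. Qed.

Lemma differentiable_cV {R : realType} {m n : nat}
    (F : 'cV[R]_n -> 'cV[R]_m) x :
  (forall i, differentiable (fun y => F y i 0) x) -> differentiable F x.
Proof.
move=> dF; rewrite (_ : F = \sum_i (fun y => F y i 0 *: delta_mx i 0)).
  by apply: differentiable_sum => i; exact: differentiableZl.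
apply/funext => y; rewrite fct_sumE {1}(matrix_sum_delta (F y)).
by apply: eq_bigr => i _; rewrite big_ord1.
Qed.

Section ProjectionDerivative.
Context {R : realType} {n : nat}.
Implicit Types x u : 'cV[R]_(1 + n).

Section Near.
Context {I : Type} {G : set_system I} {GG : ProperFilter G}.
Variables (u : I -> 'cV[R]_(1 + n)) (x : 'cV[R]_(1 + n)).
Hypothesis ux : u @ G --> x.

Lemma cvg_head : usubmx (u k) 0 0 @[k --> G] --> usubmx x 0 0.
Proof. by rewrite mxE; under eq_fun do rewrite mxE; exact: cvg_coord. Qed.

Lemma cvg_enorm_tail : enorm (dsubmx (u k)) @[k --> G] --> enorm (dsubmx x).
Proof.
apply: (continuous_cvg _ (enorm_continuous _)); apply: cvg_mxP => i j.
by rewrite mxE; under eq_fun do rewrite mxE; exact: cvg_coord.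
Qed.

(** A strict inequality between limits persists along the filter. With [u] the identity and a
    neighbourhood filter, this and the next two lemmas give local formulas for the projection. *)
Lemma near_proj_soc_id : enorm (dsubmx x) < usubmx x 0 0 ->
  \forall k \near G, u k = proj_soc (u k).
Proof.
rewrite -subr_gt0 => x21; near=> k.
rewrite proj_soc_id// /soc/= -subr_ge0 ltW//; near: k.
exact: cvgr_gt _ (cvgB cvg_head cvg_enorm_tail) _ x21.
Unshelve. all: by end_near. Qed.

Lemma near_proj_soc_eq0 : enorm (dsubmx x) < - usubmx x 0 0 ->
  \forall k \near G, 0 = proj_soc (u k).
Proof.
rewrite -subr_gt0 => x21; near=> k.
rewrite proj_soc_eq0// /soc/= head_opp tail_opp enormN -subr_ge0 ltW//.
near: k; exact: cvgr_gt _ (cvgB (cvgN cvg_head) cvg_enorm_tail) _ x21.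
Unshelve. all: by end_near. Qed.

Lemma near_proj_soc_side : usubmx x 0 0 < enorm (dsubmx x) ->
    - usubmx x 0 0 < enorm (dsubmx x) ->
  \forall k \near G, soc_side (u k) = proj_soc (u k).
Proof.
rewrite -subr_gt0 => x1r; rewrite -subr_gt0 => x1Nr; near=> k.
rewrite proj_soc_side// -subr_gt0; near: k.
  exact: cvgr_gt _ (cvgB cvg_enorm_tail cvg_head) _ x1r.
exact: cvgr_gt _ (cvgB cvg_enorm_tail (cvgN cvg_head)) _ x1Nr.
Unshelve. all: by end_near. Qed.

End Near.

(** A nonzero tail keeps the square root and the quotient by the tail norm away from 0. *)
Lemma differentiable_soc_side x : dsubmx x != 0 -> differentiable soc_side x.
Proof.
rewrite -enorm_gt0 => r0.
have dcoord i : differentiable (fun y : 'cV[R]_(1 + n) => y i 0) x.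
  exact: differentiable_coord.
have dr : differentiable (fun y => enorm (dsubmx y)) x.
  apply: (@differentiable_comp _ _ _ _
    (fun y : 'cV[R]_(1 + n) => \sum_i dsubmx y i 0 ^+ 2) Num.sqrt).
    pose f i (y : 'cV[R]_(1 + n)) := dsubmx y i 0.
    rewrite (_ : (fun _ => _) = \sum_i (f i * f i)).
      apply: differentiable_sum => i; apply: differentiableM.
        by rewrite /f; under eq_fun do rewrite mxE; exact: dcoord.
      by rewrite /f; under eq_fun do rewrite mxE; exact: dcoord.
    apply/funext => y; rewrite fct_sumE; apply: eq_bigr => i _.
    by rewrite expr2.
  apply/derivable1_diffP; apply: ex_derive; apply: is_derive1_sqrt.
  by rewrite -sqrtr_gt0.
have dh : differentiable (fun y => usubmx y 0 0) x.
  by under eq_fun do rewrite mxE; exact: dcoord.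
have da : differentiable (fun y => (usubmx y 0 0 + enorm (dsubmx y)) / 2) x.
  apply: differentiableM; last exact: differentiable_cst.
  exact: (differentiableD dh dr).
apply: differentiable_cV => i; have [j ->|j ->] := split_ordP i.
  rewrite (_ : (fun _ => _) =
    (fun y => (usubmx y 0 0 + enorm (dsubmx y)) / 2))//.
  by apply/funext => y; rewrite /soc_side col_mxEu (ord1 j) mxE eqxx mulr1n.
rewrite (_ : (fun _ => _) = (fun y : 'cV[R]_(1 + n) =>
  (usubmx y 0 0 + enorm (dsubmx y)) / 2 / enorm (dsubmx y) * y (rshift 1 j) 0)).
  apply: differentiableM; last exact: dcoord.
  apply: differentiableM; first exact: da.
  by apply: differentiableV => //; rewrite gt_eqF.
by apply/funext => y; rewrite /soc_side col_mxEd mxE [dsubmx y j 0]mxE.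
Qed.

(* On the cone and on its opposite, a shift along the axis leads to an interior
   point, near which the projection is linear; elsewhere the projection is
   differentiable at [x] itself. *)
Lemma Bsubdiff_proj_soc_neq0 x : Bsubdiff (@proj_soc R n) x !=set0.
Proof.
pose e : 'cV[R]_(1 + n) := col_mx 1 0.
have e1 : usubmx e 0 0 = 1 by rewrite col_mxKu mxE eqxx.
have e2 : dsubmx e = 0 by rewrite col_mxKd.
(* [harmonic k] is 1 / (k + 1), positive with limit 0; [a] is 1 to enter the interior of the cone
   and -1 for its opposite. *)
pose u (a : R) k : 'cV[R]_(1 + n) := x + (harmonic k * a) *: e.
have cvgu a : u a @ \oo --> x.
  rewrite -[in X in _ --> X](addr0 x) -[in X in _ --> X](scale0r e).
  rewrite -[in X in _ --> X](mul0r a).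
  apply: cvgD; first exact: cvg_cst.
  by apply: cvgZr_tmp; apply: cvgMr_tmp; exact: cvg_harmonic.
have hu a k : usubmx (u a k) 0 0 = usubmx x 0 0 + harmonic k * a.
  by rewrite /u -(opprK (_ *: e)) head_sub head_opp head_scale e1 mulr1 opprK.
have tu a k : dsubmx (u a k) = dsubmx x.
  by rewrite /u -(opprK (_ *: e)) tail_sub tail_opp tail_scale e2 scaler0 oppr0 subr0.
have [Kx|Kx|[h1 h2]] := soc_trichotomy x.
- have dP k : \forall y \near u 1 k, id y = proj_soc y.
    have u21 : enorm (dsubmx (u 1 k)) < usubmx (u 1 k) 0 0.
      by rewrite hu tu mulr1 (le_lt_trans Kx)// ltrDl invr_gt0 ltr0n.
    exact: (near_proj_soc_id (GG := nbhs_pfilter (u 1 k)) id (u 1 k) cvg_id u21).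
  have dP' k := near_eq_diff _ _ _ (dP k) (@ex_diff _ _ _ _ _ _ _ (is_diff_id (u 1 k))).
  exists 1%:M, (u 1); split => //.
    by move=> k; have [] := dP' k.
  apply: cvg_near_cst; apply: nearW => k; apply/matrixP => i j.
  by rewrite !mxE; have [_ ->] := dP' k; rewrite diff_val !mxE eqxx andbT.
- have dP k : \forall y \near u (-1) k, cst 0 y = proj_soc y.
    have u21 : enorm (dsubmx (u (-1) k)) < - usubmx (u (-1) k) 0 0.
      rewrite hu tu mulrN1 opprB; move: Kx; rewrite /soc/= head_opp tail_opp enormN.
      by move/le_lt_trans; apply; rewrite ltrDr invr_gt0 ltr0n.
    exact: (near_proj_soc_eq0 (GG := nbhs_pfilter (u (-1) k)) id (u (-1) k) cvg_id u21).
  have dP' k := near_eq_diff _ _ _ (dP k) (differentiable_cst _ _).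
  exists 0, (u (-1)); split => //.
    by move=> k; have [] := dP' k.
  apply: cvg_near_cst; apply: nearW => k; apply/matrixP => i j.
  by rewrite !mxE; have [_ ->] := dP' k; rewrite diff_cst !mxE.
- have x2 : dsubmx x != 0 by rewrite -enorm_gt0; lra.
  have [dP _] := near_eq_diff _ _ _ (near_proj_soc_side (GG := nbhs_pfilter x) id x cvg_id h1 h2)
    (differentiable_soc_side x x2).
  exists (jacobian_cV (@proj_soc R n) x), (fun=> x).
  by split=> //; exact: cvg_cst.
Qed.

End ProjectionDerivative.

(** * The equation and the Newton iteration for a general [F] *)

Section Newton.
Context {R : realType} {n : nat} (F : 'cV[R]_(1 + n) -> 'cV[R]_(1 + n)).
Variables (T : 'M[R]_(1 + n)) (b : 'cV[R]_(1 + n)).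
Hypotheses (T_unit : T \in unitmx) (T_lt1 : opnorm (invmx T) < 1).
Hypotheses (Ffirm : firmly_nonexpansive F) (Fhom : positively_homogeneous F).
Let c := opnorm (invmx T).

Lemma enorm_le_opnorm_inv x y : enorm (T *m x) <= y -> enorm x <= c * y.
Proof.
move=> Txy; rewrite -[x](mulKmx T_unit).
apply: (le_trans (enorm_mulmx_le _ _)).
by rewrite ler_wpM2l// opnorm_ge0.
Qed.

(** A kernel vector w has T w = - V w, hence |w| <= c |V w| <= c |w| with c < 1, and w = 0. *)
Lemma Bsubdiff_add_unit x V : Bsubdiff F x V -> V + T \in unitmx.
Proof.
(* [kermx] is a left kernel of row vectors, hence the passage to the transpose. *)
move=> BV; rewrite -unitmx_tr -row_free_unit -kermx_eq0; apply/rowV0P => v.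
move=> /sub_kermxP vVT; apply: trmx_inj; apply/eqP; rewrite trmx0 -enorm_eq0.
have {vVT} : V *m v^T = - (T *m v^T).
  apply/eqP; rewrite -addr_eq0 -mulmxDl -[_ + _]trmxK -trmx_mul vVT.
  by rewrite trmx0.
move=> VT; have : enorm (v^T) <= c * enorm (v^T).
  apply: enorm_le_opnorm_inv; rewrite -enormN -VT.
  exact: (Bsubdiff_nonexpansive F Ffirm _ _ _ BV).
apply: contraTT => v0; rewrite -ltNge gtr_pMl//.
by rewrite enorm_gt0 -enorm_eq0.
Qed.

Lemma equation_unique_solution :
  exists xs, unique (fun x => F x + T *m x = b) xs.
Proof.
pose g x := invmx T *m (b - F x).
have c01 : 0 <= c < 1 by rewrite opnorm_ge0.
have gc x y : enorm (g x - g y) <= c * enorm (x - y).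
  rewrite /g -mulmxBr; apply: (le_trans (enorm_mulmx_le _ _)).
  rewrite ler_wpM2l ?opnorm_ge0// opprB addrC subrKA.
  by rewrite enormB (firmly_nonexpansive_le F Ffirm).
have gP x : F x + T *m x = b <-> g x = x.
  split=> [xb|gx]; first by rewrite /g -xb addrC addKr mulKmx.
  by rewrite -[in T *m x]gx /g mulKVmx// addrC subrK.
have [xs xsP] := enorm_contraction_fixpoint g c c01 gc.
exists xs; split=> [|y /gP yP]; first exact/gP.
apply/eqP; rewrite -subr_eq0 -enorm_eq0; have := gc xs y; rewrite xsP yP.
apply: contraTT => p0; rewrite -ltNge gtr_pMl//.
by rewrite enorm_gt0 -enorm_eq0.
Qed.

(* Homogeneity gives [V x = F x], so the Newton error is governed by the
   remainder of [F] at [x]. *)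
Lemma newton_step_contract xs x y : F xs + T *m xs = b ->
  newton_step F T b x y ->
  enorm (xs - y) <= c / (1 - c) * enorm (xs - x).
Proof.
move=> xsb [V BV yb].
have Vx := Bsubdiff_homogeneous F Ffirm Fhom _ _ BV.
(* Since [V *m x = F x], the right side collapses to [V *m y - F xs], the difference of the equation
   and the Newton system. *)
have TE : T *m (xs - y) = - ((F xs - F x - V *m (xs - x)) + V *m (xs - y)).
  rewrite !mulmxBr Vx; move: yb; rewrite -xsb mulmxDl => /eqP.
  rewrite -subr_eq0 => /eqP yb; apply/eqP; rewrite -subr_eq0 -oppr_eq0 -yb.
  apply/eqP/colP => i; rewrite !mxE; ring.
have c1 : 0 < 1 - c by rewrite subr_gt0.
rewrite mulrAC ler_pdivlMr//.
have : enorm (xs - y) <= c * (enorm (xs - x) + enorm (xs - y)).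
  apply: enorm_le_opnorm_inv; rewrite TE enormN.
  apply: (le_trans (ler_enormD _ _)); rewrite lerD//.
    exact: Bsubdiff_remainder_le.
  exact: (Bsubdiff_nonexpansive F Ffirm _ _ _ BV).
by move: (enorm _) (enorm _) => ? ?; lra.
Qed.

(** Nonemptiness and nonsingularity hold at every point, thus wherever the earlier choices lead. *)
Lemma newton_well_definedP x0 : (forall x, Bsubdiff F x !=set0) ->
  newton_well_defined F T b x0.
Proof.
move=> BF x N _ _; split=> // V /Bsubdiff_add_unit Vu; split=> //.
exists (invmx (V + T) *m b); split=> [|y <-]; first by rewrite mulKVmx.
by rewrite mulKmx.
Qed.

(** The condition c < 1/2 says c < 1 - c, so the rate is below 1. Iterating the one-step bound gives
    geometric decay, which dominates the sup norm and so yields topological convergence. *)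
Lemma newton_Qlinear xs x0 x : c < 1 / 2 -> F xs + T *m xs = b ->
  newton_sequence F T b x0 x -> Qlinear_cvg x xs (c / (1 - c)).
Proof.
move=> c2 xsb [_ xP]; set q := c / (1 - c).
have c0 : 0 <= c by exact: opnorm_ge0.
have c1 : 0 < 1 - c by rewrite subr_gt0.
have q01 : 0 <= q < 1.
  apply/andP; split; first by apply: divr_ge0 => //; exact: ltW.
  by rewrite ltr_pdivrMr// mul1r; lra.
have xq k : enorm (xs - x k.+1) <= q * enorm (xs - x k).
  exact: newton_step_contract.
split=> //.
have {}xq k : enorm (xs - x k) <= q ^+ k * enorm (xs - x 0%N).
  elim: k => [|k IH]; first by rewrite mul1r.
  rewrite (le_trans (xq k))// exprS -mulrA ler_wpM2l//.
  by case/andP: q01.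
apply/cvgrPdist_le => e e0.
have : q ^+ k * enorm (xs - x 0%N) @[k --> \oo] --> (0 * enorm (xs - x 0%N) : R).
  by apply: cvgMr_tmp; apply: cvg_expr; case/andP: q01 => ? ?; rewrite ger0_norm.
rewrite mul0r => /cvgrPdist_le/(_ _ e0); apply: filterS => k /=.
rewrite sub0r normrN; apply: le_trans.
apply: (le_trans (mx_norm_le_enorm _)); apply: (le_trans (xq k)).
exact: ler_norm.
Qed.

End Newton.

(** * Specialisation to the projection onto the second order cone *)

Theorem theorem2 (R : realType) (n : nat) (b : 'cV[R]_(1 + n))
    (T : 'M[R]_(1 + n)) (T_unit : T \in unitmx)
    (T_lt1 : opnorm (invmx T) < 1) :
  exists xs : 'cV[R]_(1 + n),
    [/\ unique (fun x : 'cV[R]_(1 + n) => proj_soc x + T *m x = b) xs,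
        forall x0 : 'cV[R]_(1 + n), newton_well_defined (@proj_soc R n) T b x0 &
        opnorm (invmx T) < 1 / 2 ->
        forall (x0 : 'cV[R]_(1 + n)) (x : nat -> 'cV[R]_(1 + n)),
          newton_sequence (@proj_soc R n) T b x0 x ->
          Qlinear_cvg x xs (opnorm (invmx T) / (1 - opnorm (invmx T)))].
Proof.
have [xs [xsb xsU]] := equation_unique_solution (@proj_soc R n) T b T_unit
  T_lt1 proj_soc_firm.
exists xs; split=> // [x0|T_half x0 x xN].
  apply: newton_well_definedP => //; first exact: proj_soc_firm.
  exact: Bsubdiff_proj_soc_neq0.
apply: newton_Qlinear xN => //; first exact: proj_soc_firm.
exact: proj_soc_homogeneous.
Qed.
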